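(* Let $n\ge 12$ be an integer. For each prime power $q$ let $R=\operatorname{map}(\mathbb{A}^n(\mathbb{F}_q),\mathbb{F}_q)$ be the finite set of all functions $\mathbb{A}^n(\mathbb{F}_q)\to\mathbb{F}_q$, equip the set $R^{n\cdot n}$ of $n\times n$ matrices with entries in $R$ with the uniform probability measure, and let $E(\gamma_{q,\det})$ be the expectation value of the random variable \[ \gamma_{q,\det}(M)=\frac{|\{x\in\mathbb{A}^n(\mathbb{F}_q): \operatorname{rank} M(x)<n\}|}{q^n},\qquad M\in R^{n\cdot n}. \] Then, as $q\to\infty$ through prime powers, \[ E(\gamma_{q,\det})=\frac1q+\frac1{q^2}-\frac1{q^5}-\frac1{q^7}+O\left(\frac1{q^{12}}\right). \]
   Context: $\mathbb{F}_q$ is the finite field with $q$ elements and $\mathbb{A}^n(\mathbb{F}_q)=\mathbb{F}_q^n$ is the set of $\mathbb{F}_q$-rational points of affine $n$-space. For a matrix $M$ with entries in $R$ and $x\in\mathbb{A}^n(\mathbb{F}_q)$, $M(x)$ is the matrix over $\mathbb{F}_q$ obtained by evaluating every entry at $x$. Thus $\operatorname{rank}M(x)<n$ means that $\det M$ vanishes at $x$. *)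

(* Defs.v *)
From HB Require Import structures.
From mathcomp Require Import all_boot all_order all_algebra all_field.
From mathcomp Require Import all_classical all_reals all_analysis.
Set Implicit Arguments.
Unset Strict Implicit.
Unset Printing Implicit Defensive.
Import Order.TTheory GRing.Theory Num.Theory.
Import numFieldNormedType.Exports.
Local Open Scope ring_scope.

Definition prime_powers : set nat :=
  [set q : nat | exists p k : nat,
    [/\ prime p, (0 < k)%N & q = (p ^ k)%N]]%classic.

Definition uniform_expectation (R : realType) (Omega : finType)
    (X : Omega -> R) : R :=
  \sum_(w : Omega) (#|Omega|%:R)^-1 * X w.

(* Rational points of affine n-space, as row vectors. *)
Definition affine (F : finFieldType) (n : nat) := 'rV[F]_n.

(* The ring of all functions A^n(F) -> F; only its underlying finite set and
   pointwise evaluation are used, so no ring structure is put on it. *)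
Definition funs (F : finFieldType) (n : nat) := {ffun affine F n -> F}.

Definition eval_mx (F : finFieldType) (n : nat)
    (M : 'M[funs F n]_n) (x : affine F n) : 'M[F]_n :=
  map_mx (fun f : funs F n => f x) M.

Definition gamma_det (R : realType) (F : finFieldType) (n : nat)
    (M : 'M[funs F n]_n) : R :=
  #|[set x : affine F n | (\rank (eval_mx M x) < n)%N]|%:R / (#|F| ^ n)%:R.

Definition expected_gamma_det (R : realType) (F : finFieldType) (n : nat) : R :=
  uniform_expectation (@gamma_det R F n).

(* Main.v *)
Require Import Defs.
From HB Require Import structures.
From mathcomp Require Import all_boot all_order all_algebra all_field.
From mathcomp Require Import all_classical all_reals all_analysis.
From mathcomp Require Import ring zify.
Set Implicit Arguments.
Unset Strict Implicit.
Unset Printing Implicit Defensive.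
Import Order.TTheory GRing.Theory Num.Theory.
Import numFieldNormedType.Exports.
Local Open Scope classical_set_scope.
Local Open Scope ring_scope.

(** The value of a uniformly random matrix of functions at a fixed point is a
    uniformly random matrix over the field, so the expectation is the
    probability [1 - \prod_(1 <= i <= n) (1 - q^-i)] that such a matrix is
    singular.  The product is expanded with Shanks' finite form of Euler's
    pentagonal number theorem, in which all terms beyond
    [1 - x - x^2 + x^5 + x^7] are divisible by [x^12] as soon as [n >= 11]. *)

(** The product over [s <= i < n] is the quotient $(x;x)_n/(x;x)_s$ written without division; at
    [s = 0] the term is the full product. *)
Definition shanks_term (A : comPzRingType) (x : A) (n s : nat) : A :=
  (-1) ^+ s * x ^+ (s * n + 'C(s.+1, 2)) * \prod_(s <= i < n) (1 - x ^+ i.+1).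

Definition shanks_sum (A : comPzRingType) (x : A) (n : nat) : A :=
  \sum_(s < n.+1) shanks_term x n s.

Lemma shanks_sum_telescope (A : comPzRingType) (x : A) (n m : nat) :
  (m <= n)%N ->
  \sum_(s < m.+1) (shanks_term x n.+1 s - shanks_term x n s) =
  (-1) ^+ m.+1 * x ^+ (m.+1 * n.+1 + 'C(m.+1, 2))
    * \prod_(m <= i < n) (1 - x ^+ i.+1).
Proof.
elim: m => [|m IHm] le_mn.
  rewrite big_ord1 /shanks_term big_nat_recr //= !mul0n mul1n !expr0 expr1.
  by rewrite addn0; ring.
rewrite big_ord_recr /= IHm ?(ltnW le_mn) // /shanks_term big_nat_recr //=.
rewrite (@big_ltn _ _ _ m n) //=.
(* All exponents are written over [e = m.+1 * n.+1 + 'C(m.+1, 2)]; what remains is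
   $(1-x^{m+1})+x^{m+1}(1-x^{n+1})-1=-x^{m+1}x^{n+1}$. *)
have -> : (m.+1 * n.+1 + 'C(m.+2, 2) = m.+1 * n.+1 + 'C(m.+1, 2) + m.+1)%N.
  by rewrite [X in (_ + X)%N]binS bin1 addnA.
have -> : (m.+1 * n + 'C(m.+2, 2) = m.+1 * n.+1 + 'C(m.+1, 2))%N.
  by rewrite binS bin1 mulnS; lia.
have -> : (m.+2 * n.+1 + 'C(m.+2, 2)
           = m.+1 * n.+1 + 'C(m.+1, 2) + m.+1 + n.+1)%N.
  by rewrite binS bin1; lia.
rewrite [x ^+ (_ + _ + m.+1 + _)]exprD [x ^+ (_ + _ + m.+1)]exprD.
rewrite [(-1) ^+ m.+2]exprS.
move: (_ * _ + _)%N (\prod_(_ <= _ < _) _) ((-1) ^+ _) => e p s.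
ring.
Qed.

(** With $k=n+1$ the exponents are the generalized pentagonal numbers $k(3k-1)/2$, left by the
    telescoping sum at [m = n], and $k(3k+1)/2$, from the new last term. *)
Lemma shanks_sumS (A : comPzRingType) (x : A) (n : nat) :
  shanks_sum x n.+1 = shanks_sum x n + (-1) ^+ n.+1 *
    (x ^+ (n.+1 * n.+1 + 'C(n.+1, 2)) + x ^+ (n.+1 * n.+1 + 'C(n.+2, 2))).
Proof.
have := shanks_sum_telescope x (leqnn n).
rewrite sumrB big_geq // mulr1 => /(canRL (subrK _)) E.
rewrite /shanks_sum big_ord_recr /= E [shanks_term _ _ n.+1]/shanks_term.
by rewrite (@big_geq _ _ _ n.+1) // mulr1 mulrDr addrCA addrA.
Qed.

Lemma shanks_sum2 (A : comPzRingType) (x : A) :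
  shanks_sum x 2 = 1 - x - x ^+ 2 + x ^+ 5 + x ^+ 7.
Proof.
rewrite /shanks_sum !big_ord_recl big_ord0 /shanks_term !lift0 [val ord0]/=.
rewrite !(@big_ltn _ _ _ 0 2, @big_ltn _ _ _ 1 2) // !(@big_geq _ _ _ 2 2) //.
have -> : ('C(3, 2) = 3)%N by [].
have -> : ('C(2, 2) = 1)%N by [].
have -> : ('C(1, 2) = 0)%N by [].
rewrite !(mul0n, mul1n, addn0).
ring.
Qed.

Lemma shanks_sum_approx (R : realDomainType) (x : R) (n : nat) :
  0 <= x <= 1 ->
  `|shanks_sum x n.+2 - (1 - x - x ^+ 2 + x ^+ 5 + x ^+ 7)|
    <= (2 * n)%:R * x ^+ 12.
Proof.
move=> /andP[x0 x1]; elim: n => [|n IHn].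
  by rewrite shanks_sum2 subrr normr0 mul0r.
rewrite shanks_sumS addrAC; apply: le_trans (ler_normD _ _) _.
rewrite normrM normrX normrN1 expr1n mul1r.
rewrite [(2 * _)%N]mulnS [(2 + _)%N]addnC natrD mulrDl.
apply: lerD => //; rewrite ger0_norm ?addr_ge0 ?exprn_ge0 // mulr_natl mulr2n.
(* Past the pairs 1, 2 and 5, 7 the smallest pentagonal exponent is $12 = 3^2 + \binom{3}{2}$. *)
have exp_ge12 m : (3 <= m)%N -> (12 <= n.+3 * n.+3 + 'C(m, 2))%N.
  by move=> /(leq_bin2l 2); apply: (@leq_add 9 3); nia.
by apply: lerD; rewrite ler_wiXn2l // exp_ge12.
Qed.

(** The term [s = 0] cancels the product; each of the other [n] terms is a power of [x] with
    exponent at least [n.+1] times a factor in $[0,1]$. *)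
Lemma prod_shanks_sum_approx (R : realDomainType) (x : R) (n : nat) :
  0 <= x <= 1 ->
  `|\prod_(0 <= i < n) (1 - x ^+ i.+1) - shanks_sum x n| <= n%:R * x ^+ n.+1.
Proof.
move=> /andP[x0 x1].
rewrite /shanks_sum big_ord_recl {1}/shanks_term mul0n !expr0 !mul1r.
rewrite opprD addNKr normrN -[X in X%:R * _]card_ord mulr_natl -sumr_const.
apply: le_trans (ler_norm_sum _ _ _) _; apply: ler_sum => s _.
rewrite /shanks_term !normrM !normrX normrN1 expr1n mul1r.
rewrite -[leRHS]mulr1 ger0_norm //; apply: ler_pM; rewrite ?exprn_ge0 //.
  rewrite ler_wiXn2l // lift0 binS bin1; nia.
rewrite normr_prod; apply: prodr_ile1 => i _.
by rewrite normr_ge0 ger0_norm ?subr_ge0 ?exprn_ile1 // lerBlDr lerDl exprn_ge0.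
Qed.

Lemma prod_pentagonal_approx (R : realDomainType) (x : R) (n : nat) :
  (11 <= n)%N -> 0 <= x <= 1 ->
  `|\prod_(0 <= i < n) (1 - x ^+ i.+1) - (1 - x - x ^+ 2 + x ^+ 5 + x ^+ 7)|
    <= (3 * n)%:R * x ^+ 12.
Proof.
case: n => [|[|n]] // n_ge11 x01; have /andP[x0 x1] := x01.
have := prod_shanks_sum_approx n.+2 x01.
have := shanks_sum_approx n x01.
set S := shanks_sum _ _ => HT HP.
rewrite -(subrK S (\prod_(_ <= _ < _) _)) -addrA.
apply: le_trans (ler_normD _ _) _; apply: le_trans (lerD HP HT) _.
apply: le_trans (_ : n.+2%:R * x ^+ 12 + (2 * n)%:R * x ^+ 12 <= _).
  (* Here [n_ge11] makes the exponent [n.+3] at least 12. *)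
  by rewrite lerD2r ler_wpM2l ?ler0n // ler_wiXn2l.
by rewrite -mulrDl -natrD ler_wpM2r ?exprn_ge0 // ler_nat; lia.
Qed.

Lemma card_unitmx_density (R : realFieldType) (F : finFieldType) (n : nat) :
  #|[pred A : 'M[F]_n | A \in unitmx]|%:R / (#|F| ^ (n * n))%:R
  = \prod_(0 <= i < n) (1 - (#|F|%:R^-1 : R) ^+ i.+1).
Proof.
case: n => [|n].
  rewrite big_geq // mul0n expn0 divr1 (eq_card (_ : _ =i predT)).
    by rewrite card_mx mul0n expn0.
  by move=> A; rewrite !inE flatmx0 unitmxE det_mx00 unitr1.
have -> : #|[pred A : 'M[F]_n.+1 | A \in unitmx]| = #|'GL_n.+1[F]%g|.
  by rewrite cardsT card_sub.
have q_neq0 : #|F|%:R != 0 :> R.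
  by rewrite pnatr_eq0 -lt0n (ltn_trans _ (finNzRing_gt1 F)).
rewrite card_GL // big_add1 /= natrM natr_prod.
(* This splitting cancels the power of $q$ in the order of ['GL_n.+1[F]] and leaves one $q^{i+1}$ to
   divide each factor $q^{i+1}-1$. *)
have -> : (n.+1 * n.+1 = 'C(n.+1, 2) + \sum_(0 <= i < n.+1) i.+1)%N.
  rewrite -(big_add1 _ _ 0 n.+2 predT id) /= -[X in (_ + X)%N]add0n -big_ltn //.
  rewrite bin2_sum [in X in (_ + X)%N]binS bin1.
  have := mul_bin_diag n.+1 1.
  by rewrite bin1 /=; lia.
rewrite expnD natrM -mulf_div !natrX divff ?expf_neq0 // mul1r.
rewrite expr_sum -prodf_div; apply: eq_bigr => i _.
rewrite natrB ?expn_gt0 ?(ltn_trans _ (finNzRing_gt1 F)) // natrX.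
by rewrite mulrBl divff ?expf_neq0 // mul1r exprVn.
Qed.

Definition shift_mx (F : finFieldType) (n : nat) (N : 'M[F]_n)
    (M : 'M[funs F n]_n) : 'M[funs F n]_n :=
  \matrix_(i, j) [ffun y => M i j y + N i j].

Lemma shift_mxK (F : finFieldType) (n : nat) (N : 'M[F]_n) :
  cancel (shift_mx N) (shift_mx (- N)).
Proof.
move=> M; apply/matrixP => i j; rewrite !mxE; apply/ffunP => y.
by rewrite !ffunE addrK.
Qed.

Lemma eval_shift_mx (F : finFieldType) (n : nat) (N : 'M[F]_n)
    (M : 'M[funs F n]_n) (x : affine F n) :
  eval_mx (shift_mx N M) x = N + eval_mx M x.
Proof. by apply/matrixP => i j; rewrite !mxE ffunE addrC. Qed.

(* Averaging over all shifts of [M] by constant matrices. *)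
Lemma card_eval_mx (F : finFieldType) (n : nat) (P : pred 'M[F]_n)
    (x : affine F n) :
  (#|{: 'M[F]_n}| * #|[pred M : 'M[funs F n]_n | P (eval_mx M x)]|
   = #|{: 'M[funs F n]_n}| * #|P|)%N.
Proof.
(* Double count of pairs [(N, M)]: for fixed [N] the shift permutes the [M]; for fixed [M], adding
   [eval_mx M x] permutes the [N]. *)
transitivity (\sum_(N : 'M[F]_n) \sum_(M : 'M[funs F n]_n)
    (P (N + eval_mx M x)%R : nat))%N.
  rewrite -sum_nat_const; apply: eq_bigr => N _.
  rewrite -sum1_card big_mkcond /= (reindex_inj (can_inj (shift_mxK N))) /=.
  by apply: eq_bigr => M _; rewrite inE eval_shift_mx; case: (P _).
rewrite exchange_big -sum_nat_const; apply: eq_bigr => M _.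
rewrite -sum1_card [RHS](reindex_inj (addIr (eval_mx M x))) [RHS]big_mkcond /=.
apply: eq_bigr => N _; rewrite -topredE /=.
by case: (P _).
Qed.

Lemma expected_gamma_detE (R : realType) (F : finFieldType) (n : nat) :
  expected_gamma_det R F n
  = 1 - \prod_(0 <= i < n) (1 - (#|F|%:R^-1 : R) ^+ i.+1).
Proof.
pose sing := [pred A : 'M[F]_n | (\rank A < n)%N].
have q_gt0 : (0 < #|F|)%N by rewrite (ltn_trans _ (finNzRing_gt1 F)).
have natq_neq0 m : (#|F| ^ m)%:R != 0 :> R.
  by rewrite pnatr_eq0 -lt0n expn_gt0 q_gt0.
have Omega_neq0 : #|{: 'M[funs F n]_n}|%:R != 0 :> R.
  rewrite pnatr_eq0 -lt0n; apply/card_gt0P.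
  by exists (\matrix_(i, j) [ffun=> 0]).
have E : (\sum_(M : 'M[funs F n]_n)
    #|[set x : affine F n | (\rank (eval_mx M x) < n)%N]%SET|)%:R
    = (#|F| ^ n)%:R * (#|{: 'M[funs F n]_n}|%:R
      * (#|sing|%:R / (#|F| ^ (n * n))%:R)) :> R.
  (* Exchanging the sums over [M] and [x] reduces the expectation to a count at one point, the same
     for every [x]. *)
  transitivity ((\sum_(x : affine F n)
      #|[pred M : 'M[funs F n]_n | sing (eval_mx M x)]|)%N%:R : R).
    congr (_%:R); under eq_bigr => M _ do rewrite -sum1_card big_mkcond /=.
    rewrite exchange_big; apply: eq_bigr => x _.
    rewrite -sum1_card [RHS]big_mkcond /=.
    by apply: eq_bigr => M _; rewrite !inE.
  rewrite natr_sum.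
  under eq_bigr => x _.
    rewrite (_ : _%:R = #|{: 'M[funs F n]_n}|%:R
      * (#|sing|%:R / (#|F| ^ (n * n))%:R) :> R); first over.
    apply: (mulfI (natq_neq0 (n * n)%N)).
    by rewrite -natrM -card_mx card_eval_mx natrM card_mx; field.
  rewrite sumr_const (_ : #|_| = #|F| ^ n)%N ?mulr_natl //.
  by rewrite -[n in RHS]mul1n -card_mx.
rewrite /expected_gamma_det /uniform_expectation /gamma_det -mulr_sumr.
rewrite -mulr_suml -natr_sum E -card_unitmx_density.
have cardM :
    (#|sing| + #|[pred A : 'M[F]_n | A \in unitmx]| = #|F| ^ (n * n))%N.
  rewrite -card_mx -(cardC sing); congr (_ + _)%N; apply: eq_card => A.
  by rewrite !inE -leqNgt -row_free_unit row_leq_rank.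
have -> : #|sing|%:R
    = (#|F| ^ (n * n))%:R - #|[pred A : 'M[F]_n | A \in unitmx]|%:R :> R.
  by rewrite -cardM natrD addrK.
by rewrite [_ * _ / _]mulrAC divff // mul1r mulKf // mulrBl divff.
Qed.

Theorem mainTheorem3 (R : realType) (n : nat) (hn : (12 <= n)%N)
    (Fq : nat -> finFieldType)
    (hFq : forall q : nat, prime_powers q -> #|Fq q| = q) :
  (fun q : nat => expected_gamma_det R (Fq q) n : R^o)
    = (fun q : nat => q%:R^-1 + q%:R ^- 2 - q%:R ^- 5 - q%:R ^- 7 : R^o)
      +O_ (within prime_powers \oo) (fun q : nat => q%:R ^- 12 : R^o).
Proof.
(* Any constant [k] at least [3 * n] works, for every prime power [q], since then $x = 1/q$ lies in
   $[0,1]$. *)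
apply/eqaddOP; near=> k; rewrite near_withinE; near=> q => q_pp.
have q_gt0 : (0 < q)%N by near: q; exact: nbhs_infty_ge.
set x : R := q%:R^-1.
have x01 : 0 <= x <= 1 by rewrite invr_ge0 ler0n invf_le1 ?ltr0n ?ler1n.
rewrite !fctE /= expected_gamma_detE hFq // -!exprVn -/x.
rewrite [leLHS](_ : _ =
    `|\prod_(0 <= i < n) (1 - x ^+ i.+1) - (1 - x - x ^+ 2 + x ^+ 5 + x ^+ 7)|).
  apply: le_trans (prod_pentagonal_approx (ltnW hn) x01) _.
  rewrite ger0_norm ?exprn_ge0 ?(andP x01).1 // ler_wpM2r ?exprn_ge0 //.
  by rewrite (andP x01).1.
rewrite [RHS]distrC; congr (`| _ |); move: (\prod_(_ <= _ < _) _) => P.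
ring.
Unshelve. all: by end_near.
Qed.
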